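(* Let $\rho$ be an integer polymatroid on a finite set $E$, and suppose $M_1,M_2,\ldots,M_k$ are matroids on $E$ with $\rho(X)=r_{M_1}(X)+r_{M_2}(X)+\cdots+r_{M_k}(X)$ for all $X\subseteq E$. Let $X_i$ ($i\in E$), $X_A$ ($A\subseteq E$) and $E'=X_E$ be as in the construction of the natural matroid $M_\rho$. For each $j\in[k]$, construct the matroid $M'_j$ on $E'$ from $M_j$ by, for each $i\in E$, adding the elements of $X_i$ parallel to $i$ (or as loops if $r_{M_j}(\{i\})=0$), and then deleting $i$. Then the natural matroid $M_\rho$ equals the matroid union $M'_1\vee M'_2\vee\cdots\vee M'_k$.
   Context: An integer polymatroid on a finite set $E$ is a function $\rho:2^E\to\mathbb{N}$ with $\rho(\emptyset)=0$, $\rho(A)\le\rho(B)$ whenever $A\subseteq B$, and $\rho(A\cup B)+\rho(A\cap B)\le\rho(A)+\rho(B)$ for all $A,B\subseteq E$. Its natural matroid $M_\rho$ is constructed as follows: for each $i\in E$ let $X_i$ be a set of $\rho(\{i\})$ elements, the sets $X_i$ being pairwise disjoint; for $A\subseteq E$ put $X_A=\bigcup_{i\in A}X_i$, and $E'=X_E$. Then $M_\rho$ is the matroid on $E'$ with rank function $r(Y)=\min\{\rho(A)+|Y-X_A| : A\subseteq E\}$ for $Y\subseteq E'$ (equivalently, its independent sets are the $I\subseteq E'$ with $|I\cap X_A|\le\rho(A)$ for all $A\subseteq E$). The matroid union $N_1\vee\cdots\vee N_k$ of matroids on a common ground set $S$ is the matroid on $S$ whose independent sets are the sets $I_1\cup\cdots\cup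 I_k$ with $I_j$ independent in $N_j$. $[k]=\{1,\ldots,k\}$. *)

(* Defs.v *)
From mathcomp Require Import all_boot.
From mathcomp Require Import zify.

Set Implicit Arguments.
Unset Strict Implicit.
Unset Printing Implicit Defensive.

Section Matroids.

Variable E : finType.
Implicit Types (F : {set {set E}}) (A B I J X Y : {set E}) (x y : E).

Definition is_matroid F : bool :=
  [&& set0 \in F,
      [forall I in F, forall J : {set E}, (J \subset I) ==> (J \in F)]
    & [forall I in F, forall J in F, (#|I| < #|J|) ==>
        [exists x in J :\: I, x |: I \in F]]].

Lemma is_matroidP F :
  reflect [/\ set0 \in F,
              forall I J, I \in F -> J \subset I -> J \in F
            & forall I J, I \in F -> J \in F -> #|I| < #|J| ->
                exists2 x, x \in J :\: I & x |: I \in F]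
          (is_matroid F).
Proof.
apply: (iffP and3P) => -[F0 FS FX]; split=> //.
- move=> I J FI sJI; move/forall_inP/(_ I FI)/forallP/(_ J): FS.
  by move/implyP; apply.
- move=> I J FI FJ ltIJ; move/forall_inP/(_ I FI)/forall_inP/(_ J FJ): FX.
  by move/implyP/(_ ltIJ)/exists_inP.
- apply/forall_inP => I FI; apply/forallP => J; apply/implyP; exact: FS.
- apply/forall_inP => I FI; apply/forall_inP => J FJ; apply/implyP => ltIJ.
  exact/exists_inP/FX.
Qed.

(* The ground set is the whole type E.  As is_matroid is a boolean, two
   matroids are equal as soon as they have the same independent sets. *)
Record matroid := Matroid { indep : {set {set E}}; indepP : is_matroid indep }.

Lemma matroid_eq (M N : matroid) : indep M = indep N -> M = N.
Proof.
case: M N => [F HF] [G HG] /= eFG; subst G.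
by congr Matroid; apply: bool_irrelevance.
Qed.

Definition rank (M : matroid) (X : {set E}) : nat :=
  \max_(I : {set E} | (I \subset X) && (I \in indep M)) #|I|.

Definition circuit (M : matroid) (C : {set E}) : bool :=
  (C \notin indep M) && [forall x in C, C :\ x \in indep M].

Definition loop (M : matroid) (x : E) : bool := circuit M [set x].

Definition parallel (M : matroid) (x y : E) : bool :=
  (x != y) && circuit M [set x; y].

Definition is_rank_function (r : {set E} -> nat) : Prop :=
  [/\ forall X, r X <= #|X|,
      forall X Y, X \subset Y -> r X <= r Y
    & forall X Y, r (X :|: Y) + r (X :&: Y) <= r X + r Y].

Section RankMatroid.

Variable r : {set E} -> nat.
Hypothesis rP : is_rank_function r.

Definition rank_indep : {set {set E}} := [set I | r I == #|I|].

Lemma rank_fun_closure A B :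
  (forall x, x \in B -> r (x |: A) = r A) -> r (A :|: B) = r A.
Proof.
have [_ rmono rsub] := rP.
have [n leBn] := ubnP #|B|; elim: n => // n IHn in B leBn *.
case: (set_0Vmem B) => [->|[x Bx]] HB; first by rewrite setU0.
have cB : #|B :\ x| < n by move: leBn; rewrite (cardsD1 x B) Bx; lia.
have IH : r (A :|: B :\ x) = r A.
  by apply: IHn => // y; rewrite !inE => /andP[_ /HB].
have := rsub (A :|: B :\ x) (x |: A); rewrite IH HB //.
have -> : A :|: B :\ x :|: (x |: A) = A :|: B.
  apply/setP => y; rewrite !inE; case: eqP => [->|_]; rewrite ?Bx /= ?orbT //.
  by case: (y \in A); rewrite ?orbT ?orbF.
have := rmono A ((A :|: B :\ x) :&: (x |: A)).
rewrite subsetI subsetUl subsetUr => /(_ isT).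
have := rmono A (A :|: B) (subsetUl _ _); lia.
Qed.

Lemma rank_indep_extend I X : I \in rank_indep -> #|I| < r X ->
  exists2 x, x \in X :\: I & x |: I \in rank_indep.
Proof.
have [rcard rmono rsub] := rP.
rewrite inE => /eqP rI lt.
case: (boolP [exists x in X :\: I, x |: I \in rank_indep]).
  by move/exists_inP.
move/exists_inPn => none.
have HI : r (I :|: (X :\: I)) = r I.
  apply: rank_fun_closure => x Xx; have := none x Xx; rewrite inE.
  have := rcard (x |: I); have := rmono _ _ (subsetUr [set x] I).
  by move: Xx; rewrite inE cardsU1 => /andP[-> _]; lia.
have := rmono X (I :|: (X :\: I)); rewrite HI rI.
have -> : X \subset I :|: (X :\: I).
  by apply/subsetP => x Xx; rewrite !inE Xx andbT orbN.
move=> /(_ isT); lia.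
Qed.

Lemma rank_indep_matroid : is_matroid rank_indep.
Proof.
have [rcard rmono rsub] := rP.
apply/is_matroidP; split.
- by rewrite inE; have := rcard set0; rewrite cards0; lia.
- move=> I J; rewrite !inE => /eqP rI sJI.
  have := rsub J (I :\: J).
  have -> : J :|: (I :\: J) = I.
    apply/setP => x; rewrite !inE; case: (boolP (x \in J)) => // Jx.
    by rewrite (subsetP sJI).
  have := rcard (I :\: J); have := rcard J; rewrite cardsDS //.
  have := subset_leq_card sJI; lia.
- move=> I J FI; rewrite [J \in _]inE => /eqP rJ lt.
  by apply: rank_indep_extend => //; rewrite rJ.
Qed.

Definition matroid_of_rank : matroid := Matroid rank_indep_matroid.

Lemma rank_matroid_of_rank X : rank matroid_of_rank X = r X.
Proof.
have [rcard rmono rsub] := rP.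
have [F0 _ _] := is_matroidP _ rank_indep_matroid.
apply/eqP; rewrite eqn_leq; apply/andP; split.
  apply/bigmax_leqP => I /andP[sIX]; rewrite inE => /eqP <-; exact: rmono.
pose P I := (I \subset X) && (I \in rank_indep).
have P0 : P set0 by rewrite /P sub0set F0.
have [I /andP[sIX FI] Imax] := @arg_maxnP _ set0 P (fun I => #|I|) P0.
apply: (@leq_trans #|I|); last first.
  by rewrite /rank (bigmax_sup I) // sIX.
rewrite leqNgt; apply/negP => lt.
have [x] := rank_indep_extend FI lt; rewrite inE => /andP[Ix Xx] FxI.
have := Imax (x |: I); rewrite /P FxI andbT subUset sub1set Xx sIX.
by move=> /(_ isT); rewrite cardsU1 Ix; lia.
Qed.

End RankMatroid.

Section Union.

Variables (k : nat) (M : 'I_k -> matroid).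

Definition union_indep : {set {set E}} :=
  [set \bigcup_(j < k) f j | f : {ffun 'I_k -> {set E}}
                           & [forall j, f j \in indep (M j)]].

Lemma union_indepP I :
  reflect (exists f : 'I_k -> {set E},
             (forall j, f j \in indep (M j)) /\ I = \bigcup_(j < k) f j)
          (I \in union_indep).
Proof.
apply: (iffP imsetP) => [[f]|[f [Ff ->]]].
  by rewrite inE => /forallP Ff ->; exists f.
exists [ffun j => f j].
  by rewrite inE; apply/forallP => j; rewrite ffunE.
by apply: eq_bigr => j _; rewrite ffunE.
Qed.

Lemma union_indep_colour I (j0 : 'I_k) :
  (I \in union_indep) =
  [exists c : {ffun E -> 'I_k},
     [forall j, [set x in I | c x == j] \in indep (M j)]].
Proof.
apply/union_indepP/existsP => [[f [Ff ->]]|[c /forallP Fc]]; last first.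
  exists (fun j => [set x in I | c x == j]); split=> //.
  apply/setP => x; apply/idP/bigcupP => [Ix|[j _]].
    by exists (c x) => //; rewrite inE Ix eqxx.
  by rewrite inE => /andP[].
exists [ffun x => odflt j0 [pick j | x \in f j]]; apply/forallP => j.
have [_ FS _] := is_matroidP _ (indepP (M j)).
apply: FS (Ff j) _; apply/subsetP => x; rewrite inE ffunE.
case/andP => /bigcupP[i _ fix_]; case: pickP => [l fl /eqP <- //|].
by move/(_ i); rewrite fix_.
Qed.

Lemma union_indep_matroid : is_matroid union_indep.
Proof.
apply/is_matroidP; split.
- apply/union_indepP; exists (fun=> set0); split=> [j|].
    by have [] := is_matroidP _ (indepP (M j)).
  by rewrite big1.
- move=> I J /union_indepP[f [Ff ->]] sJ; apply/union_indepP.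
  exists (fun j => J :&: f j); split=> [j|].
    have [_ FS _] := is_matroidP _ (indepP (M j)).
    by apply: FS (Ff j) _; apply: subsetIr.
  by rewrite -big_distrr /=; apply/esym/setIidPl.
move=> I J UI UJ ltIJ.
have [j0 _] : exists j0 : 'I_k, true.
  have /card_gt0P[x] : 0 < #|J| by lia.
  by move/union_indepP: UJ => [f [_ ->]] /bigcupP[j _ _]; exists j.
move: UI UJ; rewrite !(union_indep_colour _ j0) => /existsP[c0 Fc0].
move=> /existsP[d /forallP Fd].
pose P (c : {ffun E -> 'I_k}) :=
  [forall j, [set x in I | c x == j] \in indep (M j)].
pose agree (c : {ffun E -> 'I_k}) := #|[set x in I :&: J | c x == d x]|.
have [c /forallP Fc cmax] := @arg_maxnP _ c0 P agree Fc0.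
have cardC (K : {set E}) (e : {ffun E -> 'I_k}) :
    #|K| = \sum_j #|[set x in K | e x == j]|.
  rewrite -sum1_card (partition_big e predT) //=; apply: eq_bigr => j _.
  by rewrite -sum1_card; apply: eq_bigl => x; rewrite inE.
have [j ltj] : exists j,
    #|[set x in I | c x == j]| < #|[set x in J | d x == j]|.
  apply/existsP; move: ltIJ; apply: contraLR => /existsPn le.
  by rewrite -leqNgt (cardC I c) (cardC J d) leq_sum // => j _; rewrite leqNgt.
have [_ _ FX] := is_matroidP _ (indepP (M j)).
have [x] := FX _ _ (Fc j) (Fd j) ltj.
rewrite !inE => /and3P[nIx Jx /eqP dx] Fx.
pose c' := [ffun y => if y == x then j else c y].
have Fc' l : [set y in x |: I | c' y == l] \in indep (M l).
  have [_ FS _] := is_matroidP _ (indepP (M l)).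
  case: (eqVneq l j) => [->|nlj].
    rewrite (_ : [set y in _ | _] = x |: [set x in I | c x == j]) //.
    apply/setP => y; rewrite !inE ffunE.
    by case: (y == x); rewrite //= eqxx.
  apply: FS (Fc l) _; apply/subsetP => y; rewrite !inE ffunE.
  by case: (y == x) => //=; rewrite eq_sym (negPf nlj).
exists x; last first.
  by rewrite (union_indep_colour _ j0); apply/existsP; exists c'; apply/forallP.
rewrite inE Jx andbT; apply/negP => Ix.
have xI : x |: I = I by apply/setUidPr; rewrite sub1set.
have /cmax : P c' by apply/forallP => l; rewrite -{1}xI.
rewrite /geq /= /agree leqNgt => /negP; apply; apply: proper_card; apply/properP; split.
  apply/subsetP => y; rewrite !inE ffunE => /andP[-> /eqP cy] /=.
  by case: (eqVneq y x) => [->|_]; rewrite ?dx ?cy.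
exists x; first by rewrite !inE Ix Jx ffunE eqxx dx eqxx.
by move: nIx; rewrite !inE Ix Jx dx.
Qed.

Definition matroid_union : matroid := Matroid union_indep_matroid.

End Union.

End Matroids.

Section Restriction.

Variables (S T : finType) (f : S -> T).
Hypothesis injf : injective f.

Definition restrict_indep (N : matroid T) : {set {set S}} :=
  [set I : {set S} | f @: I \in indep N].

Lemma restrict_indep_matroid N : is_matroid (restrict_indep N).
Proof.
have [F0 FS FX] := is_matroidP _ (indepP N).
apply/is_matroidP; split.
- by rewrite inE imset0.
- by move=> I J; rewrite !inE => FI sJI; apply: FS FI _; apply: imsetS.
move=> I J; rewrite !inE => FI FJ ltIJ.
have [|t] := FX _ _ FI FJ; first by rewrite !card_imset.
rewrite inE => /andP[nI /imsetP[x Jx tx]]; subst t => FxI.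
exists x; last by rewrite inE imsetU1.
by rewrite inE Jx andbT; apply: contra nI => /(imset_f f).
Qed.

(* The restriction of N to the image of the injection f. *)
Definition restrict (N : matroid T) : matroid S :=
  Matroid (restrict_indep_matroid N).

End Restriction.

Section NaturalMatroid.

Variable E : finType.

Record polymatroid := Polymatroid {
  pm_fun :> {set E} -> nat;
  pm_set0 : pm_fun set0 = 0;
  pm_mono : forall A B : {set E}, A \subset B -> pm_fun A <= pm_fun B;
  pm_submod : forall A B : {set E},
    pm_fun (A :|: B) + pm_fun (A :&: B) <= pm_fun A + pm_fun B }.

Variable rho : polymatroid.

(* E' is the disjoint union of sets X_i of cardinality rho {i}. *)
Definition nat_ground : finType := {i : E & 'I_(rho [set i])}.

Definition nat_part (i : E) : {set nat_ground} := [set x | tag x == i].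

Definition nat_block (A : {set E}) : {set nat_ground} :=
  \bigcup_(i in A) nat_part i.

(* min {rho A + |Y - X_A| : A \subset E} *)
Definition nat_rank (Y : {set nat_ground}) : nat :=
  let F (A : {set E}) := rho A + #|Y :\: nat_block A| in
  F [arg min_(A < set0) F A].

Lemma card_nat_part i : #|nat_part i| = rho [set i].
Proof.
have -> : nat_part i = [set Tagged (fun i => 'I_(rho [set i])) j | j : 'I_(rho [set i])].
  apply/setP => x; rewrite inE; apply/eqP/imsetP => [<-|[j _ ->] //].
  by exists (tagged x) => //; case: x.
rewrite card_imset ?card_ord // => j1 j2 /eqP.
by rewrite eq_Tagged => /eqP.
Qed.

Lemma in_nat_block A x : (x \in nat_block A) = (tag x \in A).
Proof.
apply/bigcupP/idP => [[i Ai]|Ax]; first by rewrite inE => /eqP ->.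
by exists (tag x); rewrite ?inE.
Qed.

Lemma nat_rank_le Y A : nat_rank Y <= rho A + #|Y :\: nat_block A|.
Proof. by rewrite /nat_rank; case: arg_minnP => // B _; apply. Qed.

Lemma nat_rank_ex Y : exists A, nat_rank Y = rho A + #|Y :\: nat_block A|.
Proof. by rewrite /nat_rank; case: arg_minnP => // B _ _; exists B. Qed.

Lemma nat_rank_function : is_rank_function nat_rank.
Proof.
split.
- move=> Y; have := nat_rank_le Y set0.
  by rewrite pm_set0 /nat_block big_set0 setD0.
- move=> Y Z sYZ; have [A ->] := nat_rank_ex Z.
  apply: leq_trans (nat_rank_le Y A) _.
  by rewrite leq_add2l subset_leq_card // setSD.
move=> Y Z; have [A ->] := nat_rank_ex Y; have [B ->] := nat_rank_ex Z.
have := nat_rank_le (Y :|: Z) (A :|: B).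
have := nat_rank_le (Y :&: Z) (A :&: B).
have := pm_submod rho A B.
suff: #|(Y :|: Z) :\: nat_block (A :|: B)| + #|(Y :&: Z) :\: nat_block (A :&: B)|
   <= #|Y :\: nat_block A| + #|Z :\: nat_block B| by lia.
have cE (W : {set nat_ground}) : #|W| = \sum_x (x \in W).
  by rewrite -sum1_card big_mkcond; apply: eq_bigr => x _; case: (x \in W).
rewrite !cE -!big_split /=; apply: leq_sum => x _.
rewrite !inE !in_nat_block !inE.
by case: (x \in Y); case: (x \in Z); case: (tag x \in A); case: (tag x \in B).
Qed.

Definition natural_matroid : matroid nat_ground :=
  matroid_of_rank nat_rank_function.

Lemma rank_natural_matroid Y : rank natural_matroid Y = nat_rank Y.
Proof. exact: rank_matroid_of_rank. Qed.

Lemma natural_matroid_indepP (I : {set nat_ground}) :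
  reflect (forall A : {set E}, #|I :&: nat_block A| <= rho A)
          (I \in indep natural_matroid).
Proof.
have [rcard _ _] := nat_rank_function.
have cI A := cardsID (nat_block A) I.
rewrite inE; apply: (iffP eqP) => [rI A|HI].
  by have := nat_rank_le I A; rewrite rI -{1}(cI A) leq_add2r.
apply/eqP; rewrite eqn_leq rcard /=; have [A ->] := nat_rank_ex I.
by rewrite -{1}(cI A) leq_add2r.
Qed.

(* N, on the disjoint union of E and E', is obtained from M by adding, for
   every i, the elements of X_i parallel to i, or as loops if r_M {i} = 0. *)
Definition parallel_extension (M : matroid E)
    (N : matroid (E + nat_ground)%type) : Prop :=
  restrict inl_inj N = M /\
  (forall (i : E) (x : nat_ground), x \in nat_part i ->
     if rank M [set i] == 0 then loop N (inr x)
     else parallel N (inl i) (inr x)).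

(* M' is a parallel extension of M with the elements of E deleted. *)
Definition parallel_replacement (M : matroid E) (M' : matroid nat_ground) :
    Prop :=
  exists2 N : matroid (E + nat_ground)%type,
    parallel_extension M N & M' = restrict inr_inj N.

End NaturalMatroid.

Section Pullback.

Variables (S T : finType) (f : S -> T).

Definition pullback_indep (N : matroid T) : {set {set S}} :=
  [set I : {set S} | (#|f @: I| == #|I|) && (f @: I \in indep N)].

Lemma pullback_indep_matroid N : is_matroid (pullback_indep N).
Proof.
have [F0 FS FX] := is_matroidP _ (indepP N).
apply/is_matroidP; split.
- by rewrite inE imset0 F0 !cards0.
- move=> I J; rewrite !inE => /andP[/imset_injP injI FI] sJI.
  rewrite (FS _ _ FI (imsetS _ sJI)) andbT; apply/imset_injP.
  by move=> x y /(subsetP sJI) Ix /(subsetP sJI) Iy; apply: injI.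
move=> I J; rewrite !inE => /andP[/eqP cI FI] /andP[/eqP cJ FJ] ltIJ.
have [|t] := FX _ _ FI FJ; first by rewrite cI cJ.
rewrite inE => /andP[nI /imsetP[x Jx tx]]; subst t => FxI.
have nIx : x \notin I by apply: contra nI => /(imset_f f).
exists x; first by rewrite inE nIx.
by rewrite inE imsetU1 FxI andbT !cardsU1 nI nIx cI.
Qed.

Definition pullback (N : matroid T) : matroid S :=
  Matroid (pullback_indep_matroid N).

End Pullback.

Section ParallelReplacement.

Variables (E : finType) (rho : polymatroid E).

Definition ext_proj (z : E + nat_ground rho) : E :=
  match z with inl i => i | inr x => tag x end.

Lemma rank1_eq0 (M : matroid E) i :
  (rank M [set i] == 0) = ([set i] \notin indep M).
Proof.
apply/idP/idP => [/eqP r0|ni].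
  apply/negP => Fi; have : #|[set i]| <= rank M [set i].
    by rewrite /rank (bigmax_sup [set i]) // subxx.
  by rewrite r0 cards1.
rewrite -leqn0; apply/bigmax_leqP => I /andP[].
rewrite subset1 => /orP[/eqP ->|/eqP ->]; last by rewrite cards0.
by rewrite (negPf ni).
Qed.

Lemma pullback_parallel_extension (M : matroid E) :
  parallel_extension M (pullback ext_proj M).
Proof.
have [F0 _ _] := is_matroidP _ (indepP M).
split.
  apply: matroid_eq; apply/setP => I; rewrite !inE -imset_comp.
  have -> : [set (ext_proj \o inl) x | x in I] = I.
    by rewrite (@eq_imset _ _ _ id) // imset_id.
  by rewrite card_imset ?eqxx //; apply: inl_inj.
move=> i x; rewrite inE => /eqP xi; subst i; rewrite rank1_eq0.
have p1 z : [set z] \in indep (pullback ext_proj M) = ([set ext_proj z] \in indep M).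
  by rewrite inE imset_set1 !cards1.
have p0 : set0 \in indep (pullback ext_proj M).
  by rewrite inE imset0 F0 !cards0.
case: ifP => nF.
  rewrite /loop /circuit p1 nF; apply/forall_inP => y; rewrite inE => /eqP ->.
  by rewrite setDv p0.
rewrite /parallel /circuit /=; apply/andP; split.
  by rewrite inE imsetU1 imset_set1 /= setUid cards1 cards2.
move/negbFE: nF => Fi.
pose a : E + nat_ground rho := inl (tag x); pose b : E + nat_ground rho := inr x.
have Da : [set a; b] :\ a = [set b].
  by apply/setP => z; rewrite !inE; case: eqVneq => [->|].
have Db : [set a; b] :\ b = [set a].
  by apply/setP => z; rewrite !inE; case: (eqVneq z b) => [->|]; rewrite ?orbF.
apply/forall_inP => y /set2P[]->; first by rewrite Da p1.
by rewrite Db p1.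
Qed.

Lemma parallel_replacement_exists (M : matroid E) :
  exists M' : matroid (nat_ground rho), parallel_replacement M M'.
Proof.
by exists (restrict inr_inj (pullback ext_proj M)), (pullback ext_proj M);
  first exact: pullback_parallel_extension.
Qed.

End ParallelReplacement.

(* Main.v *)
Require Import Defs.
From mathcomp Require Import all_boot.
From mathcomp Require Import zify.

(** By the matroid union theorem, I is independent in the union of the M'_j iff
    |Y| <= sum_j r_{M'_j}(Y) for every subset Y of I.  Replacing elements by
    parallel copies gives r_{M'_j}(Y) = r_{M_j}(A), where A is the set of indices
    i such that Y meets X_i; the sum is therefore rho(A), and the condition is
    the one defining the independent sets of the natural matroid.

    The union theorem is proved by Rado's shrinking argument.  Allow every
    element of I to use every matroid, and delete allowed pairs (element,
    matroid) as long as the rank condition persists.  By submodularity, no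
    element can keep two matroids, so that a minimal set of allowed pairs is
    a partition of I into independent sets. *)

Set Implicit Arguments.
Unset Strict Implicit.
Unset Printing Implicit Defensive.

(** * Rank functions, closure and parallel elements *)

Section Rank.

Variables (E : finType) (M : matroid E).
Implicit Types (A I J X Y : {set E}) (a b : E).

Lemma rank_ge_card I X : I \subset X -> I \in indep M -> #|I| <= rank M X.
Proof. by move=> sIX FI; rewrite /rank (bigmax_sup I) // sIX. Qed.

Lemma rank_le_card X : rank M X <= #|X|.
Proof. by apply/bigmax_leqP => I /andP[/subset_leq_card]. Qed.

Lemma rank_mono X Y : X \subset Y -> rank M X <= rank M Y.
Proof.
move=> sXY; apply/bigmax_leqP => I /andP[sIX FI].
exact: rank_ge_card (subset_trans sIX sXY) FI.
Qed.

Lemma rank_set0 : rank M set0 = 0.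
Proof. by apply/eqP; rewrite -leqn0 -(cards0 E) rank_le_card. Qed.

Lemma rank_witness X :
  exists I, [/\ I \subset X, I \in indep M & #|I| = rank M X].
Proof.
have [F0 _ _] := is_matroidP _ (indepP M).
have [|I /andP[sIX FI] eI] := @eq_bigmax_cond _
  (fun I : {set E} => (I \subset X) && (I \in indep M)) (fun I => #|I|).
  by apply/card_gt0P; exists set0; rewrite unfold_in sub0set.
by exists I; split=> //; apply: esym eI.
Qed.

Lemma rank_indepE I : (I \in indep M) = (rank M I == #|I|).
Proof.
apply/idP/eqP => [FI|rI].
  by apply/eqP; rewrite eqn_leq rank_le_card rank_ge_card.
have [J [sJI FJ cJ]] := rank_witness I.
by rewrite -(_ : J = I) //; apply/eqP; rewrite eqEcard sJI cJ rI /=.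
Qed.

Lemma basis_extension I X : I \subset X -> I \in indep M ->
  exists J, [/\ I \subset J, J \subset X, J \in indep M & #|J| = rank M X].
Proof.
have [_ _ FX] := is_matroidP _ (indepP M).
have [n] := ubnP (rank M X - #|I|); elim: n => // n IHn in I *.
move=> len sIX FI; have leI := rank_ge_card sIX FI.
case: (ltnP #|I| (rank M X)) => [ltI|geI]; last by exists I; split=> //; lia.
have [B [sBX FB cB]] := rank_witness X.
have [|x] := FX _ _ FI FB; first by rewrite cB.
rewrite inE => /andP[nIx Bx] FxI.
have [||J [sIJ sJX FJ cJ]] := IHn (x |: I) _ _ FxI.
- by rewrite cardsU1 nIx; lia.
- by rewrite subUset sub1set (subsetP sBX).
by exists J; split=> //; apply: subset_trans (subsetUr _ _) sIJ.
Qed.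

(** A basis [I] of the intersection extends to a basis [J] of the union. The traces of [J] on [X]
    and on [Y] are independent, cover [J], and both contain [I]. *)
Lemma rank_submod X Y :
  rank M (X :|: Y) + rank M (X :&: Y) <= rank M X + rank M Y.
Proof.
have [_ FS _] := is_matroidP _ (indepP M).
have [I [sI FI <-]] := rank_witness (X :&: Y).
have [|J [sIJ sJ FJ <-]] := @basis_extension I (X :|: Y) _ FI.
  by apply: subset_trans sI _; rewrite subIset ?subsetUl.
have := rank_ge_card (subsetIr J X) (FS _ _ FJ (subsetIl J X)).
have := rank_ge_card (subsetIr J Y) (FS _ _ FJ (subsetIl J Y)).
have := cardsUI (J :&: X) (J :&: Y); rewrite -setIUr (setIidPl sJ).
have : I \subset (J :&: X) :&: (J :&: Y).
  by rewrite -setIIr subsetI sIJ.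
move/subset_leq_card; lia.
Qed.

Lemma rank_is_rank_function : is_rank_function (rank M).
Proof. split; [exact: rank_le_card | exact: rank_mono | exact: rank_submod]. Qed.

Lemma loop_rank a : loop M a -> rank M [set a] = 0.
Proof.
case/andP=> + _; rewrite rank_indepE cards1.
by have := rank_le_card [set a]; rewrite cards1; lia.
Qed.

Lemma rank_pair_eq0 a b :
  rank M [set a] = 0 -> rank M [set b] = 0 -> rank M [set a; b] = 0.
Proof. by have := rank_submod [set a] [set b]; lia. Qed.

Lemma parallel_sym a b : parallel M a b = parallel M b a.
Proof. by rewrite /parallel eq_sym setUC. Qed.

Lemma parallel_rank a b : parallel M a b -> rank M [set a; b] = rank M [set a].
Proof.
case/and3P=> nab; rewrite rank_indepE cards2 nab => nind /forall_inP ind.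
have := ind b (set22 _ _).
have -> : [set a; b] :\ b = [set a].
  by apply/setP => z; rewrite !inE; case: (eqVneq z b) nab => [->|_ _];
    rewrite ?orbF // eq_sym => /negPf ->.
rewrite rank_indepE cards1 => /eqP ra.
have := rank_le_card [set a; b]; rewrite cards2 nab.
have := @rank_mono [set a] [set a; b]; rewrite sub1set set21 => /(_ isT).
by move: nind ra; lia.
Qed.

(** Submodularity on [A] and [[set a; b]], which share [a]: what lies in the closure of [a] lies in
    the closure of [A]. *)
Lemma rank_add_parallel A a b :
  a \in A -> rank M [set a; b] = rank M [set a] -> rank M (b |: A) = rank M A.
Proof.
move=> Aa rab; have := rank_submod A [set a; b].
have -> : A :|: [set a; b] = b |: A.
  by apply/setP => x; rewrite !inE; case: (eqVneq x a) => [->|]; rewrite ?Aa ?orbT //= orbC.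
have := @rank_mono [set a] (A :&: [set a; b]).
rewrite subsetI !sub1set Aa set21 => /(_ isT).
have := rank_mono (subsetUr [set b] A); lia.
Qed.

End Rank.

Lemma rank_restrict (S T : finType) (f : S -> T) (injf : injective f)
    (N : matroid T) (X : {set S}) :
  rank (restrict injf N) X = rank N (f @: X).
Proof.
apply/eqP; rewrite eqn_leq; apply/andP; split; apply/bigmax_leqP => I /andP[sIX].
  by rewrite inE => FI; rewrite -(card_imset _ injf) rank_ge_card ?imsetS.
move=> FI; have eI : f @: (f @^-1: I) = I.
  apply/setP => y; apply/imsetP/idP => [[x + ->]|Iy]; first by rewrite inE.
  by have /imsetP[x Xx eyx] := subsetP sIX y Iy; exists x; rewrite // inE -eyx.
rewrite -eI card_imset //; apply: rank_ge_card; last by rewrite inE eI.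
apply/subsetP => x; rewrite inE => /(subsetP sIX)/imsetP[x' Xx' /injf ->] //.
Qed.

(** * Sufficiency in the matroid union theorem *)

Section Union.

Variables (E : finType) (k : nat) (M : 'I_k -> matroid E).
Implicit Types (I Y : {set E}) (L : {set E * 'I_k}).

Let allowed L Y (j : 'I_k) : {set E} := [set e in Y | (e, j) \in L].

Let allowed_rank L Y : nat := \sum_(j < k) rank (M j) (allowed L Y j).

(** The Hall-Rado condition for sending each element of [I] to a matroid allowed by [L] so that all
    classes are independent. *)
Let feasible I L : bool :=
  [forall Y : {set E}, (Y \subset I) ==> (#|Y| <= allowed_rank L Y)].

(** If [e] kept two matroids, deleting either pair would violate the condition, at sets [Y1] and
    [Y2] that both contain [e]. Submodularity then contradicts feasibility at their union and at
    their intersection without [e]. *)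
Lemma minimal_feasible_functional I L e j1 j2 :
  minset (feasible I) L -> (e, j1) \in L -> (e, j2) \in L -> j1 = j2.
Proof.
case/minsetP => /forallP Lfeas Lmin L1 L2; apply/eqP/negPn/negP => nj.
have violated j : (e, j) \in L -> exists2 Y : {set E}, (Y \subset I) &
    allowed_rank (L :\ (e, j)) Y < #|Y|.
  move=> Lj; have /forallPn[Y] : ~~ feasible I (L :\ (e, j)).
    apply/negP => /Lmin/(_ (subsetDl _ _)) /setP/(_ (e, j)).
    by rewrite !inE eqxx Lj.
  by rewrite negb_imply -ltnNge => /andP[sY lt]; exists Y.
have tight j Y : Y \subset I ->
    allowed_rank (L :\ (e, j)) Y < #|Y| -> e \in Y.
  move=> sY lt; apply/negPn/negP => nYe; have := Lfeas Y; rewrite sY /= => leY.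
  move: lt; rewrite ltnNge => /negP; apply; apply: leq_trans leY _.
  apply: leq_sum => l _; apply: rank_mono; apply/subsetP => x.
  rewrite !inE => /andP[Yx ->]; rewrite Yx andbT /=.
  by apply: contra nYe => /eqP[<- _].
have [Y1 sY1 lt1] := violated _ L1; have [Y2 sY2 lt2] := violated _ L2.
have Y1e := tight _ _ sY1 lt1; have Y2e := tight _ _ sY2 lt2.
(* As [j1] and [j2] differ, a pair deleted on one side survives on the other, so the union loses
   nothing. On the intersection, removing [e] makes both deletions harmless. *)
have sub : allowed_rank L (Y1 :|: Y2) + allowed_rank L (Y1 :&: Y2 :\ e)
    <= allowed_rank (L :\ (e, j1)) Y1 + allowed_rank (L :\ (e, j2)) Y2.
  rewrite -!big_split; apply: leq_sum => l _.
  apply: leq_trans (rank_submod _ _ _).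
  apply: leq_add; apply: rank_mono; apply/subsetP => x; rewrite !inE !xpair_eqE.
    case: (eqVneq x e) => [->|_] /=; last by rewrite andb_orl.
    rewrite Y1e Y2e /= => ->; rewrite !andbT.
    by rewrite -negb_and; apply: contra nj => /andP[/eqP <- /eqP <-].
  by case: (x == e) => //= /andP[/andP[-> ->] ->].
(* The two strict inequalities gain 2, while removing [e] costs only 1. *)
have := Lfeas (Y1 :|: Y2); rewrite subUset sY1 sY2 /=.
have := Lfeas (Y1 :&: Y2 :\ e).
have -> : (Y1 :&: Y2) :\ e \subset I.
  by apply: subset_trans (subsetDl _ _) _; rewrite subIset ?sY1.
have := cardsUI Y1 Y2; rewrite (cardsD1 e (Y1 :&: Y2)) inE Y1e Y2e /=; lia.
Qed.

Theorem union_indep_rank I :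
  (forall Y, Y \subset I -> #|Y| <= \sum_(j < k) rank (M j) Y) ->
  I \in union_indep M.
Proof.
move=> HI.
have feasT : feasible I setT.
  apply/forallP => Y; apply/implyP => /HI; congr (_ <= _); apply: eq_bigr => j _.
  by congr rank; apply/setP => x; rewrite !inE andbT.
have [L Lmin _] := minset_exists feasT.
have /minsetP[/forallP Lfeas _] := Lmin.
(* Feasibility at a singleton leaves its element at least one matroid. *)
have some e : e \in I -> exists j, (e, j) \in L.
  move=> Ie; apply/existsP; move: (Lfeas [set e]); rewrite sub1set Ie cards1 /=.
  apply: contraLR => /existsPn none; rewrite /allowed_rank big1 // => j _.
  rewrite -[RHS](rank_set0 (M j)); congr rank; apply/setP => x; rewrite !inE.
  by case: eqP => //= ->; apply/negbTE/none.
have cardL : \sum_(j < k) #|allowed L I j| <= #|I|.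
  have cardE (K : {set E}) : #|K| = \sum_e (if e \in K then 1 else 0).
    by rewrite -sum1_card big_mkcond.
  under eq_bigr => j _ do rewrite cardE.
  rewrite exchange_big cardE; apply: leq_sum => e _.
  case: (boolP (e \in I)) => Ie; last first.
    by rewrite big1 // => j _; rewrite inE (negPf Ie).
  have [j0 L0] := some e Ie; rewrite (bigD1 j0) //= big1 ?addn0.
    by case: ifP.
  move=> j nj; rewrite inE Ie /=; case: ifP => // Lj.
  by rewrite (minimal_feasible_functional Lmin Lj L0) eqxx in nj.
(* [#|I|] is at most the sum of the ranks of the classes, hence of their sizes, which is at most
   [#|I|]. Equality throughout gives every class full rank. *)
have indepL j : allowed L I j \in indep (M j).
  rewrite rank_indepE eqn_leq rank_le_card /= leqNgt; apply/negP => lt.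
  have ltL : allowed_rank L I < \sum_(j < k) #|allowed L I j|.
    rewrite /allowed_rank (bigD1 j) //= [ltnRHS](bigD1 j) //= -addSn leq_add //.
    by apply: leq_sum => i _; apply: rank_le_card.
  by have := leq_trans ltL cardL; have := Lfeas I; rewrite subxx /=; lia.
apply/union_indepP; exists (allowed L I); split=> //.
apply/setP => e; apply/idP/bigcupP => [Ie|[j _]]; last by rewrite inE => /andP[].
by have [j Lj] := some e Ie; exists j; rewrite // inE Ie.
Qed.

End Union.

(** * Ranks in parallel replacements *)

Section ParallelReplacement.

Variables (E : finType) (rho : polymatroid E).

(** An index and its copy span each other: two loops have rank 0 throughout, and a parallel pair has
    rank 1, like each of its members. *)
Lemma parallel_extension_rank (M : matroid E)
    (N : matroid (E + nat_ground rho)%type) (x : nat_ground rho) :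
  parallel_extension M N ->
  rank N [set inl (tag x); inr x] = rank N [set inl (tag x)] /\
  rank N [set inl (tag x); inr x] = rank N [set inr x].
Proof.
case=> MN /(_ (tag x) x); rewrite inE => /(_ (eqxx _)).
have -> : rank M [set tag x] = rank N [set inl (tag x)].
  by rewrite -MN rank_restrict imset_set1.
case: eqP => [ra /loop_rank rb|_ par]; first by rewrite rank_pair_eq0.
by split; [|rewrite setUC]; apply: parallel_rank; rewrite // parallel_sym.
Qed.

(** Inside the extension [N], the copies in [Y] and their indices span each other, so both sets have
    the rank of their union. *)
Lemma parallel_replacement_rank (M : matroid E) (M' : matroid (nat_ground rho))
    (Y : {set nat_ground rho}) :
  parallel_replacement M M' -> rank M' Y = rank M (tag @: Y).
Proof.
case=> N NM ->; have [<- _] := NM; rewrite !rank_restrict.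
have rN := rank_is_rank_function N.
rewrite -(rank_fun_closure rN (B := inl @: (tag @: Y))); last first.
  move=> _ /imsetP[_ /imsetP[x Yx ->] ->].
  apply: (rank_add_parallel (a := inr x)); first exact: imset_f.
  by rewrite setUC; case: (parallel_extension_rank x NM).
rewrite setUC (rank_fun_closure rN) //.
move=> _ /imsetP[x Yx ->]; apply: (rank_add_parallel (a := inl (tag x))).
  by do 2!apply: imset_f.
by case: (parallel_extension_rank x NM).
Qed.

End ParallelReplacement.

Theorem theorem2p5 (E : finType) (rho : polymatroid E) (k : nat)
    (M : 'I_k -> matroid E)
    (rho_sum : forall X : {set E}, rho X = \sum_(j < k) rank (M j) X)
    (M' : 'I_k -> matroid (nat_ground rho))
    (M'_repl : forall j : 'I_k, parallel_replacement (M j) (M' j)) :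
  natural_matroid rho = matroid_union M'.
Proof.
apply: matroid_eq; apply/setP => I.
apply/natural_matroid_indepP/idP => [HI|/union_indepP[f [Ff ->]] A].
  (* The bound for [Y] comes from [A := tag @: Y], whose block contains [Y]. *)
  apply: union_indep_rank => Y sYI.
  under eq_bigr => j _ do rewrite (parallel_replacement_rank Y (M'_repl j)).
  rewrite -rho_sum; apply: leq_trans (HI _); apply: subset_leq_card.
  rewrite subsetI sYI; apply/subsetP => x Yx.
  by rewrite in_nat_block imset_f.
rewrite rho_sum setIC big_distrr /=.
have leU : #|\bigcup_(j < k) (nat_block rho A :&: f j)|
    <= \sum_(j < k) #|nat_block rho A :&: f j|.
  elim/big_rec2: _ => [|j n B _ leB]; first by rewrite cards0.
  by apply: leq_trans (leq_card_setU _ _) _; rewrite leq_add2l.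
apply: leq_trans leU _; apply: leq_sum => j _.
(* The part of [f j] in the block of [A] is independent with tags in [A], so its size is at most the
   rank of [A] in [M j]. *)
have [_ FS _] := is_matroidP _ (indepP (M' j)).
have /eqP <- : rank (M' j) (nat_block rho A :&: f j) == #|nat_block rho A :&: f j|.
  by rewrite -rank_indepE; apply: FS (Ff j) (subsetIr _ _).
rewrite (parallel_replacement_rank _ (M'_repl j)); apply: rank_mono.
by apply/subsetP => _ /imsetP[x + ->]; rewrite inE in_nat_block => /andP[].
Qed.
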